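(* Let $R=\{r_{ab}\}_{N\times N}$ be the transition rate matrix of an irreducible continuous-time Markov jump process on states $\{1,\dots,N\}$: for $a\neq b$, $r_{ab}\ge 0$ is the rate of jumps from $b$ to $a$, and $r_{bb}=-\sum_{a\neq b} r_{ab}$. Let $\boldsymbol{\pi}$ be the unique stationary distribution and $Z=\int_0^\infty\left(e^{Rt}-\boldsymbol{\pi}\boldsymbol{1}^\top\right)\mathrm{d}t$ the fundamental matrix. Fix distinct states $i\neq j$. Regard $R$ (hence $Z$) as a function of the single off-diagonal rate $r_{ij}>0$, with all other off-diagonal rates fixed and $r_{jj}=-\sum_{a\neq j}r_{aj}$ adjusted accordingly. For $m=1,2$, let $a^{(m)}_l$ ($l=1,\dots,N$) and $b^{(m)}_{kl}$ ($k\neq l$, $(k,l)\neq(i,j)$) be real coefficients not depending on $r_{ij}$ (they define the observables $Q_m=\sum_l a^{(m)}_l\tau_l(\tau)+\sum_{k\neq l,(k,l)\neq(i,j)} b^{(m)}_{kl}n_{kl}(\tau)$, which do not count transitions $j\to i$), and set $$c^{(m)}_l=a^{(m)}_l+\sum_{k\neq l,\ (k,l)\neq(i,j)} b^{(m)}_{kl}\,r_{kl}.$$ Define $$\chi_{ij}^{(1)(2)}=\frac{\sum_l c^{(1)}_l (Z_{li}-Z_{lj})}{\sum_l c^{(2)}_l (Z_{li}-Z_{lj})}.$$ Then, at every value of $r_{ij}$ where the denominator is nonzero, $\frac{\mathrm{d}\chi_{ij}^{(1)(2)}}{\mathrm{d}r_{ij}}=0$.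
   Context: $\tau_l(\tau)$ denotes the total time spent in state $l$ up to time $\tau$ and $n_{kl}(\tau)$ the number of jumps from $l$ to $k$ up to time $\tau$. Note that $c^{(m)}_l$ does not depend on $r_{ij}$. $\chi_{ij}^{(1)(2)}$ equals the long-time limit of the ratio of the responses $\frac{\mathrm{d}\langle Q_1(\tau)\rangle}{\mathrm{d}r_{ij}}/\frac{\mathrm{d}\langle Q_2(\tau)\rangle}{\mathrm{d}r_{ij}}$. $\boldsymbol{1}$ is the all-ones column vector. *)

(* Defs.v *)
From HB Require Import structures.
From mathcomp Require Import all_boot all_order all_algebra.
From mathcomp Require Import all_classical all_reals all_analysis.
Set Implicit Arguments. Unset Strict Implicit. Unset Printing Implicit Defensive.
Import Order.TTheory GRing.Theory Num.Theory.
Import numFieldNormedType.Exports.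
Local Open Scope classical_set_scope.
Local Open Scope ring_scope.

Section Defs.
Variables (R : realType) (N : nat).

(** k-th power of a square matrix (works for any N, including N = 0). *)
Definition mxpow (A : 'M[R]_N) (k : nat) : 'M[R]_N := iter k (mulmx A) 1%:M.

Definition expmx (A : 'M[R]_N) : 'M[R]_N :=
  \matrix_(a, b) limn (series (fun k : nat => (mxpow A k) a b / (k`!)%:R)).

(** Rate matrix of a Markov jump process, column convention:
    A a b (a != b) is the rate of jumps b -> a, and columns sum to zero. *)
Definition rate_matrix (A : 'M[R]_N) : Prop :=
  (forall a b, a != b -> 0 <= A a b) /\
  (forall b, A b b = - \sum_(a < N | a != b) A a b).

Definition jump_rel (A : 'M[R]_N) : rel 'I_N := fun b a => (a != b) && (0 < A a b).
Definition irreducible (A : 'M[R]_N) : Prop := forall a b, connect (jump_rel A) a b.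

Definition stationary (A : 'M[R]_N) (p : 'I_N -> R) : Prop :=
  (forall a, \sum_(b < N) A a b * p b = 0) /\ (forall a, 0 <= p a) /\
  \sum_(a < N) p a = 1.

Definition fundamental (A : 'M[R]_N) (p : 'I_N -> R) : 'M[R]_N :=
  \matrix_(a, b) Rintegral lebesgue_measure `[0%R, +oo[%classic
                   (fun t : R => expmx (t *: A) a b - p a).

Definition offdiag_rate (r : 'I_N -> 'I_N -> R) (i j : 'I_N) (x : R) (a b : 'I_N) : R :=
  if (a == i) && (b == j) then x else r a b.

Definition rate_mx (r : 'I_N -> 'I_N -> R) (i j : 'I_N) (x : R) : 'M[R]_N :=
  \matrix_(a, b) (if a == b then - \sum_(k < N | k != b) offdiag_rate r i j x k b
                  else offdiag_rate r i j x a b).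

Definition coef_c (r : 'I_N -> 'I_N -> R) (i j : 'I_N) (av : 'I_N -> R)
  (bv : 'I_N -> 'I_N -> R) (l : 'I_N) : R :=
  av l + \sum_(k < N | (k != l) && ~~ ((k == i) && (l == j))) bv k l * r k l.

Definition resp (Z : 'M[R]_N) (c : 'I_N -> R) (i j : 'I_N) : R :=
  \sum_(l < N) c l * (Z l i - Z l j).

End Defs.

(* Main.v *)
(* For a generator A with stationary vector p, each column of exp(tA) - p 1^T
   solves v' = A v with zero coordinate sum.  Along such a solution
   sum_a v_a^2 / p_a decreases at the rate given by the Dirichlet form of v / p,
   which dominates it (Poincare inequality, proved by chaining jumps along paths
   of the irreducible chain); so v decays exponentially.  Integrating v' = A v
   over [0, +oo) gives A Z = p 1^T - 1 and 1^T Z = 0.  Hence w = Z (e_i - e_j) is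
   the only zero-sum solution of A w = e_j - e_i.  Changing the rate r_ij from y
   to x adds (x - y) (e_i - e_j) e_j^T to A, which only rescales the right-hand
   side, so w only gets multiplied by a scalar, and this scalar cancels in chi:
   chi is locally constant. *)
Require Import Defs.
From HB Require Import structures.
From mathcomp Require Import all_boot all_order all_algebra.
From mathcomp Require Import all_classical all_reals all_analysis measurable_realfun.
From mathcomp Require Import ring lra.
Set Implicit Arguments. Unset Strict Implicit. Unset Printing Implicit Defensive.
Import Order.TTheory GRing.Theory Num.Theory.
Import numFieldNormedType.Exports.
Local Open Scope ring_scope.

(** * Convergence and differentiation of the matrix exponential, entry by entry *)

Section MatrixExponential.
Variables (R : realType) (N : nat).
Implicit Types A B : 'M[R]_N.

Definition mxnorm1 A : R := \sum_a \sum_b `|A a b|.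

Lemma mxnorm1_ge0 A : 0 <= mxnorm1 A.
Proof. by apply: sumr_ge0 => a _; apply: sumr_ge0. Qed.

Lemma mxnorm1_row A a : \sum_b `|A a b| <= mxnorm1 A.
Proof.
rewrite /mxnorm1 [leRHS](bigD1 a) //= lerDl.
by apply: sumr_ge0 => c _; apply: sumr_ge0.
Qed.

Lemma norm_mulmx_le A B a b (C : R) : (forall c, `|B c b| <= C) ->
  `|(A *m B) a b| <= mxnorm1 A * C.
Proof.
move=> BC; have C0 : 0 <= C by apply: le_trans (BC a).
rewrite mxE (le_trans (ler_norm_sum _ _ _)) //.
rewrite (le_trans (y := \sum_c `|A a c| * C)) //.
  by apply: ler_sum => c _; rewrite normrM ler_wpM2l.
by rewrite -mulr_suml ler_wpM2r // mxnorm1_row.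
Qed.

Lemma norm_mxpow_le A k a b : `|mxpow A k a b| <= mxnorm1 A ^+ k.
Proof.
elim: k a b => [|k IH] a b.
  by rewrite expr0 mxE normr_nat -[leRHS]/(1%:R) ler_nat leq_b1.
by rewrite exprS; apply: norm_mulmx_le => c; exact: IH.
Qed.

Lemma mxpowZ (t : R) A k : mxpow (t *: A) k = t ^+ k *: mxpow A k.
Proof.
elim: k => [|k IH]; first by rewrite expr0 scale1r.
rewrite /mxpow !iterS -!/(mxpow _ _) IH -scalemxAl -scalemxAr scalerA.
by rewrite exprS.
Qed.

(** The left factor [B] makes this family of power series closed under formal differentiation, which
    turns [B] into [B *m A]; the exponential itself is the case [B = 1%:M]. *)
Definition expmx_coef B A a b (k : nat) : R := (B *m mxpow A k) a b / k`!%:R.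

Lemma expmx_pseries t A a b :
  expmx (t *: A) a b = limn (pseries (expmx_coef 1%:M A a b) t).
Proof.
rewrite mxE; congr (limn (series _)); apply/funext => k /=.
rewrite /expmx_coef mul1mx mxpowZ mxE [RHS]mulrC mulrA //.
Qed.

(** The terms are dominated by [mxnorm1 B] times those of the scalar exponential series at
    [mxnorm1 A * |t|]. *)
Lemma is_cvg_expmx_coef B A a b t : cvgn (pseries (expmx_coef B A a b) t).
Proof.
apply: normed_cvg.
have h : cvgn (series (mxnorm1 B *: exp_coeff (mxnorm1 A * `|t|) : R^nat)).
  by apply: is_cvg_seriesZ; apply: is_cvg_series_exp_coeff.
apply: series_le_cvg h => [n|n|n] //=.
  by rewrite /exp_coeff /= !mulr_ge0 ?invr_ge0 ?exprn_ge0 ?mulr_ge0 ?mxnorm1_ge0.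
rewrite !normrM normfV normrX normr_nat /GRing.scale /= /exp_coeff /=.
rewrite exprMn -mulrA [_^-1 * _]mulrC !mulrA.
rewrite -[leRHS]/(mxnorm1 B * _) !mulrA ler_wpM2r ?invr_ge0 ?ler0n // ler_wpM2r ?exprn_ge0 //.
by apply: norm_mulmx_le => c; exact: norm_mxpow_le.
Qed.

Lemma pseries_diffs_expmx_coef B A a b :
  pseries_diffs (expmx_coef B A a b) = expmx_coef (B *m A) A a b.
Proof.
apply/funext => k; rewrite /pseries_diffs /expmx_coef.
rewrite /mxpow iterS -/(mxpow _ _) mulmxA factS natrM invfM mulrCA.
by rewrite mulVKf // pnatr_eq0.
Qed.

Lemma is_derive_expmx A a b (t : R) :
  is_derive t 1 (fun s => expmx (s *: A) a b) ((A *m expmx (t *: A)) a b).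
Proof.
under eq_fun do rewrite expmx_pseries.
have -> : (A *m expmx (t *: A)) a b =
    limn (pseries (pseries_diffs (expmx_coef 1%:M A a b)) t).
  rewrite pseries_diffs_expmx_coef mul1mx mxE.
  under eq_bigr do rewrite expmx_pseries.
  symmetry; apply: cvg_lim => //.
  (* The finite sum over [c] is exchanged with the partial sums, so that the limit can be taken
     column entry by column entry. *)
  rewrite (_ : pseries _ _ = fun n => \sum_c A a c *
             pseries (expmx_coef 1%:M A c b) t n); last first.
    apply/funext => n; rewrite /pseries /series /=.
    under [RHS]eq_bigr do rewrite mulr_sumr.
    rewrite exchange_big /=; apply: eq_bigr => k _.
    rewrite /expmx_coef mxE !mulr_suml; apply: eq_bigr => c _.
    by rewrite mul1mx !mulrA.
  apply: cvg_big => [|c _]; [exact: add_continuous|apply: cvgMr].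
  exact: is_cvg_expmx_coef.
(* Termwise differentiation at [t] asks for convergence, up to the second formal derivative, at some
   point beyond [|t|]; these series converge everywhere, so adding 1 is an arbitrary choice. *)
apply: (@pseries_snd_diffs _ _ (`|t| + 1)).
- exact: is_cvg_expmx_coef.
- by rewrite pseries_diffs_expmx_coef; exact: is_cvg_expmx_coef.
- by rewrite !pseries_diffs_expmx_coef; exact: is_cvg_expmx_coef.
- by rewrite [ltRHS]ger0_norm ?addr_ge0 // ltrDl.
Qed.

Lemma expmx0 A : expmx (0 *: A) = 1%:M.
Proof.
apply/matrixP => a b; rewrite expmx_pseries.
(* Only the term [k = 0] survives at time 0, and the partial sum of index 0 is empty, so the partial
   sums are constant from index 1 on. *)
apply: cvg_lim => //; apply: cvg_near_cst; exists 1%N => // n /= n1.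
rewrite /pseries /series /= (big_ltn n1) expr0 mulr1 /expmx_coef mul1mx.
rewrite fact0 divr1 big_nat_cond big1 ?addr0 // => k /andP[/andP[k0 _] _].
by rewrite expr0n gtn_eqF // mulr0.
Qed.

End MatrixExponential.

(** * Dirichlet form, Poincare inequality and uniqueness of zero-sum solutions *)

Section Dissipation.
Variables (R : realType) (N : nat).
Variables (A : 'M[R]_N) (p : 'I_N -> R).
Hypotheses (rateA : rate_matrix A) (irrA : irreducible A).
Hypothesis statp : stationary A p.

Lemma rate_matrix_col_sum b : \sum_a A a b = 0.
Proof. by case: rateA => _ diagA; rewrite (bigD1 b) //= diagA addNr. Qed.

(** Some state has positive mass because the total is 1, and positivity spreads along jumps: if
    [p c = 0], the balance equation at [c] is a vanishing sum of nonnegative inflows, so no positive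
    mass can jump into [c]. *)
Lemma stationary_gt0 a : 0 < p a.
Proof.
case: rateA => offA _; case: statp => Ap [p0 p1].
have step b c : jump_rel A b c -> 0 < p b -> 0 < p c.
  move=> /andP[cb Acb] pb; rewrite lt_neqAle p0 andbT eq_sym; apply/eqP => pc.
  have := Ap c; rewrite (bigD1 c) //= pc mulr0 add0r => /psumr_eq0P H.
  have /eqP : A c b * p b = 0.
    apply: H => [k kc|]; last by rewrite eq_sym.
    by rewrite mulr_ge0 // offA // eq_sym.
  by rewrite mulf_eq0 !gt_eqF.
have [b pb] : exists b, 0 < p b.
  apply/existsP; apply: contraT; rewrite negb_exists => /forallP H.
  move: p1; rewrite big1 => [/eqP|b _]; first by rewrite eq_sym oner_eq0.
  by apply/eqP; rewrite eq_le p0 andbT leNgt H.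
have /connectP[s] := irrA b a.
elim: s b pb => [|c s IH] b pb /= => [_ ->//|/andP[bc cs] aE].
exact: (IH c (step _ _ bc pb) cs aE).
Qed.

(** Twice the usual Dirichlet form. The negative diagonal rates are harmless, since the square
    vanishes at [a = b]. *)
Definition dirichlet (phi : 'I_N -> R) : R :=
  \sum_a \sum_b A a b * p b * (phi a - phi b) ^+ 2.

Lemma dirichlet_term_ge0 phi a b : 0 <= A a b * p b * (phi a - phi b) ^+ 2.
Proof.
have [->|ab] := eqVneq a b; first by rewrite subrr expr0n mulr0.
case: rateA => offA _; case: statp => _ [p0 _].
by rewrite mulr_ge0 ?sqr_ge0 // mulr_ge0 // offA.
Qed.

Lemma dirichlet_ge0 phi : 0 <= dirichlet phi.
Proof.
by apply: sumr_ge0 => a _; apply: sumr_ge0 => b _; exact: dirichlet_term_ge0.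
Qed.

Lemma jump_le_dirichlet phi a b :
  A a b * p b * (phi a - phi b) ^+ 2 <= dirichlet phi.
Proof.
rewrite /dirichlet [leRHS](bigD1 a) //= [X in _ <= X + _](bigD1 b) //= -addrA.
rewrite lerDl addr_ge0 //; apply: sumr_ge0 => c _.
  exact: dirichlet_term_ge0.
by apply: sumr_ge0 => d _; exact: dirichlet_term_ge0.
Qed.

(** In the expanded square, the [phi a ^+ 2] terms vanish by stationarity and the [phi b ^+ 2] terms
    by the zero column sums; only the cross term is left. Along [v' = A v] the right-hand side is
    minus the derivative of the sum of [v a ^+ 2 / p a]. *)
Lemma dirichletE (v : 'I_N -> R) :
  dirichlet (fun a => v a / p a) =
  - (2 * \sum_a (v a / p a) * (\sum_b A a b * v b)).
Proof.
set phi := fun a => v a / p a; case: statp => Ap _.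
have vE b : v b = p b * phi b.
  by rewrite /phi mulrC divfK // gt_eqF // stationary_gt0.
have col b : \sum_a A a b * (p b * phi b ^+ 2) = 0.
  by rewrite -mulr_suml rate_matrix_col_sum mul0r.
have row a : \sum_b A a b * p b * phi a ^+ 2 = 0.
  by rewrite -mulr_suml Ap mul0r.
transitivity (\sum_a \sum_b A a b * p b * phi a ^+ 2 +
   \sum_b \sum_a A a b * (p b * phi b ^+ 2)
   - 2 * \sum_a phi a * (\sum_b A a b * v b)).
  rewrite [X in _ + X - _]exchange_big /= mulr_sumr -big_split -sumrB /=.
  apply: eq_bigr => a _; rewrite 2!mulr_sumr -big_split -sumrB /=.
  by apply: eq_bigr => b _; rewrite (vE b); ring.
by under eq_bigr do rewrite row; under [X in _ + X - _]eq_bigr do rewrite col;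
   rewrite !big1_eq addr0 sub0r.
Qed.

(** Induction along a path of jumps from [a] to [b]: each jump is controlled by a single summand of
    the Dirichlet form. The constant depends on the path but not on [phi]. *)
Lemma oscillation_bound a b :
  exists2 C, 0 <= C & forall phi, (phi a - phi b) ^+ 2 <= C * dirichlet phi.
Proof.
have /connectP[s] := irrA a b.
elim: s a => [|c s IH] a /= => [_ ->|/andP[/andP[ca Aca] cs] bE].
  by exists 0 => // phi; rewrite subrr expr0n mul0r.
have [C C0 CP] := IH c cs bE.
have w0 : 0 < A c a * p a by rewrite mulr_gt0 // stationary_gt0.
exists (2 * (A c a * p a)^-1 + 2 * C) => [|phi].
  by rewrite addr_ge0 // mulr_ge0 // ltW // invr_gt0.
have h1 : (phi c - phi a) ^+ 2 <= (A c a * p a)^-1 * dirichlet phi.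
  by rewrite mulrC ler_pdivlMr // mulrC jump_le_dirichlet.
have h2 := CP phi.
(* This is [(X + Y)^2 <= 2 X^2 + 2 Y^2] for the two legs through [c], whence the factors 2 in the
   constant. *)
have h3 := sqr_ge0 ((phi a - phi c) - (phi c - phi b)).
rewrite mulrDl -!mulrA.
set X := _^-1 * _ in h1 *; set Y := C * _ in h2 *; nra.
Qed.

(** Zero sum of [v] means that [v / p] has mean zero under [p], so the left-hand side is a variance,
    and averaging the oscillation bounds over pairs of states controls it. *)
Lemma poincare : exists2 C, 0 < C & forall v : 'I_N -> R, \sum_a v a = 0 ->
  \sum_a v a ^+ 2 / p a <= C * dirichlet (fun a => v a / p a).
Proof.
have [K KP] : {K : 'I_N -> 'I_N -> R | forall a b, 0 <= K a b /\
    forall phi, (phi a - phi b) ^+ 2 <= K a b * dirichlet phi}.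
  exists (fun a b => projT1 (cid2 (oscillation_bound a b))) => a b.
  by case: cid2.
pose C := \sum_a \sum_b K a b * p b * p a.
have p_gt0 := stationary_gt0.
have C0 : 0 <= C.
  apply: sumr_ge0 => a _; apply: sumr_ge0 => b _.
  by rewrite !mulr_ge0 ?(ltW (p_gt0 _)) //; have [] := KP a b.
(* [C] is only known to be nonnegative, whereas the decay rate will be obtained by inverting this
   constant. *)
exists (C + 1) => [|v v0]; first by rewrite ltr_wpDl.
set phi := fun a => v a / p a.
have vE b : v b = p b * phi b by rewrite /phi mulrC divfK // gt_eqF.
case: statp => _ [_ p1].
(* The variance of [phi] under [p] is half its mean square oscillation. *)
have var : 2 * \sum_a v a ^+ 2 / p a =
    \sum_a \sum_b (p a * p b) * (phi a - phi b) ^+ 2.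
  have e a b : (p a * p b) * (phi a - phi b) ^+ 2 =
      (p a * phi a ^+ 2) * p b + p a * (p b * phi b ^+ 2)
      - 2 * v a * v b by rewrite !vE; ring.
  under [RHS]eq_bigr => a _ do
    (under eq_bigr => b _ do rewrite e;
     rewrite sumrB big_split /= -!mulr_sumr v0 p1 mulr0 subr0 mulr1).
  rewrite big_split /= -mulr_suml p1 mul1r mulr2n mulrDl mul1r.
  by congr (_ + _); apply: eq_bigr => a _; rewrite vE; field; rewrite gt_eqF.
have D0 := dirichlet_ge0 phi.
have : 2 * \sum_a v a ^+ 2 / p a <= C * dirichlet phi.
  rewrite var /C mulr_suml; apply: ler_sum => a _.
  rewrite mulr_suml; apply: ler_sum => b _.
  rewrite [leRHS](_ : _ = p a * p b * (K a b * dirichlet phi)); last by ring.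
  by rewrite ler_wpM2l ?mulr_ge0 ?(ltW (p_gt0 _)) //; have [] := KP a b.
have : 0 <= \sum_a v a ^+ 2 / p a.
  by apply: sumr_ge0 => a _; rewrite divr_ge0 ?sqr_ge0 // ltW.
by set X := \sum_a _; nra.
Qed.

(** By [dirichletE] the Dirichlet form of [v / p] vanishes, and the Poincare inequality then kills
    the weighted norm of [v]. *)
Lemma kernel_sum0 (v : 'I_N -> R) : (forall a, \sum_b A a b * v b = 0) ->
  \sum_a v a = 0 -> forall a, v a = 0.
Proof.
move=> Av v0 a; have [C _ /(_ v v0)] := poincare.
rewrite dirichletE [X in _ * - (_ * X)]big1 => [|b _]; last by rewrite Av mulr0.
rewrite mulr0 oppr0 mulr0 => le0; have p_gt0 := stationary_gt0.
have pos b : 0 <= v b ^+ 2 / p b by rewrite divr_ge0 ?sqr_ge0 // ltW.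
have /psumr_eq0P : \sum_a v a ^+ 2 / p a = 0.
  by apply/eqP; rewrite eq_le le0 sumr_ge0.
move=> /(_ (fun b _ => pos b) a isT) /eqP.
by rewrite mulf_eq0 invr_eq0 sqrf_eq0 [p a == 0]gt_eqF // orbF => /eqP.
Qed.

End Dissipation.

(** * Integration of exponentially decaying functions over the half-line *)

Section ExponentialDecay.
Variable R : realType.
Local Notation mu := (@lebesgue_measure R).
Local Notation halfline := (`[0, +oo[%classic : set R).

Lemma is_derive_expR_scale (k x : R) :
  is_derive x 1 (fun t => expR (k * t)) (k * expR (k * x)).
Proof.
have h : is_derive x 1 (fun t : R => k * t) k.
  rewrite -[X in is_derive _ _ _ X]mulr1 -[k * 1]/(k *: 1).
  exact: is_deriveZ.
by rewrite mulrC; exact: is_derive1_comp.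
Qed.

Lemma cvg_expRN_scale (k : R) : 0 < k ->
  (expR (- k * t) @[t --> +oo] --> (0 : R))%classic.
Proof.
move=> k0; under eq_fun do rewrite mulNr.
apply: (@cvg_comp _ _ _ (fun t => k * t) (fun y => expR (- y)) _ (pinfty_nbhs R)).
  exact: gt0_cvgMry.
exact: cvgr_expR.
Qed.

Lemma is_derive_continuous (g dg : R -> R) :
  (forall x : R, is_derive x 1 g (dg x)) -> continuous g.
Proof.
move=> dgx x; apply: differentiable_continuous.
by apply/derivable1_diffP; exact: ex_derive.
Qed.

Lemma continuous_expR_scale (k : R) : continuous (fun t => expR (k * t)).
Proof.
apply: (@is_derive_continuous _ (fun x => k * expR (k * x))) => x.
exact: is_derive_expR_scale.
Qed.

(** For a nonnegative integrand the fundamental theorem yields a finite extended integral, which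
    already gives integrability. *)
Lemma Rintegral_FTC2y_ge0 (g G : R -> R) :
  (forall x, 0 <= x -> 0 <= g x) -> continuous g ->
  (forall x : R, is_derive x 1 G (g x)) ->
  (G x @[x --> +oo] --> (0 : R))%classic ->
  mu.-integrable halfline (EFin \o g) /\
  \int[mu]_(x in halfline) g x = - G 0.
Proof.
move=> g0 cg dG Goo.
have E : (\int[mu]_(x in halfline) (g x)%:E = 0%:E - (G 0)%:E)%E.
  apply: ge0_continuous_FTC2y => //.
  - by apply: continuous_subspaceT => x; exact: cg.
  - by apply: cvg_at_right_filter; exact: (is_derive_continuous dG).
  - by move=> x _; rewrite derive1E derive_val.
split; last by rewrite /Rintegral E sub0e.
apply/integrableP; split.
  apply/measurable_EFinP; apply: measurable_funTS.
  exact: continuous_measurable_fun.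
rewrite [ltLHS](_ : _ = (0%:E - (G 0)%:E)%E) ?ltry // -E.
apply: eq_integral => x /set_mem /=; rewrite in_itv /= andbT => x0.
by rewrite ger0_norm // g0.
Qed.

Variables (K k : R).
Hypotheses (K0 : 0 <= K) (k0 : 0 < k).

Lemma integrable_exp_decay :
  mu.-integrable halfline (EFin \o (fun t => K * expR (- k * t))) /\
  \int[mu]_(t in halfline) (K * expR (- k * t)) = K / k.
Proof.
(* Puts the value in the form [- G 0] for the antiderivative [G t = - (K / k) * expR (- k * t)]. *)
have -> : K / k = - ((- (K / k)) * expR (- k * 0)).
  by rewrite mulr0 expR0 mulr1 opprK.
apply: (@Rintegral_FTC2y_ge0 _ (fun t => - (K / k) * expR (- k * t))).
- by move=> x _; rewrite mulr_ge0 // expR_ge0.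
- by move=> x; apply: cvgMr; exact: continuous_expR_scale.
- move=> x; rewrite [X in is_derive _ _ _ X](_ : _ = - (K / k) *: (- k * expR (- k * x))).
    by apply: is_deriveZ; exact: is_derive_expR_scale.
  by rewrite /GRing.scale /= mulrA mulrNN divfK // gt_eqF.
- rewrite -[X in (_ --> X)%classic](mulr0 (- (K / k))).
  by apply: cvgMr; exact: cvg_expRN_scale.
Qed.

Lemma integrable_decay (g : R -> R) : continuous g ->
  (forall t, 0 <= t -> `|g t| <= K * expR (- k * t)) ->
  mu.-integrable halfline (EFin \o g).
Proof.
move=> cg gK; apply: le_integrable integrable_exp_decay.1 => //.
  apply/measurable_EFinP; apply: measurable_funTS.
  exact: continuous_measurable_fun.
move=> x /=; rewrite in_itv /= andbT => x0; rewrite lee_fin.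
by rewrite [leRHS]ger0_norm ?gK // mulr_ge0 // expR_ge0.
Qed.

(* Adding [K * exp (- k t)] makes the integrand nonnegative, the only case
   covered by the library's fundamental theorem on half-lines. *)
Lemma Rintegral_FTC2y_decay (g G : R -> R) :
  continuous g -> (forall x : R, is_derive x 1 G (g x)) ->
  (forall t, 0 <= t -> `|g t| <= K * expR (- k * t)) ->
  (G x @[x --> +oo] --> (0 : R))%classic ->
  \int[mu]_(t in halfline) g t = - G 0.
Proof.
move=> cg dG gK Goo; have [ie ve] := integrable_exp_decay.
have ig := integrable_decay cg gK.
pose H t := G t - K / k * expR (- k * t).
have [_] : mu.-integrable halfline (EFin \o (fun t => g t + K * expR (- k * t)))
   /\ \int[mu]_(t in halfline) (g t + K * expR (- k * t)) = - H 0.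
  apply: Rintegral_FTC2y_ge0.
  - move=> x x0; have := gK _ x0; rewrite ler_norml => /andP[h _].
    by rewrite -lerBlDr sub0r.
  - move=> x; apply: cvgD; first exact: cg.
    by apply: cvgMr; exact: continuous_expR_scale.
  - move=> x; apply: is_deriveD.
    rewrite [X in is_derive _ _ _ X](_ : _ = - (K / k *: (- k * expR (- k * x)))).
      by apply: is_deriveN; apply: is_deriveZ; exact: is_derive_expR_scale.
    by rewrite /GRing.scale /= -mulNr mulrA mulrNN divfK // gt_eqF.
  - rewrite -[X in (_ --> X)%classic](subrr 0); apply: cvgB => //.
    rewrite -[X in (_ --> X)%classic](mulr0 (K / k)).
    by apply: cvgMr; exact: cvg_expRN_scale.
by rewrite RintegralD // ve /H mulr0 expR0 mulr1 opprB addrC => /addrI.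
Qed.

End ExponentialDecay.

(** * Exponential convergence to [p] and the equations satisfied by the fundamental matrix *)

Section FundamentalMatrix.
Variables (R : realType) (N : nat).
Variables (A : 'M[R]_N) (p : 'I_N -> R).
Hypotheses (rateA : rate_matrix A) (irrA : irreducible A).
Hypothesis statp : stationary A p.
Local Notation mu := (@lebesgue_measure R).
Local Notation halfline := (`[0, +oo[%classic : set R).

(* Lyapunov function: the squared norm of [v] weighted by [1 / p]. *)
Lemma solution_decay (v : 'I_N -> R -> R) :
  (forall a (t : R), is_derive t 1 (v a) (\sum_c A a c * v c t)) ->
  (forall t, \sum_a v a t = 0) ->
  exists2 k, 0 < k & exists2 K, 0 <= K &
    forall a t, 0 <= t -> `|v a t| <= K * expR (- k * t).
Proof.
move=> dv v0; have p_gt0 := stationary_gt0 rateA irrA statp.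
have [C C0 CP] := poincare rateA irrA statp.
pose V t := \sum_a v a t ^+ 2 / p a.
(* The Poincare inequality gives [V' <= - V / C = - 2 k V], so [W] is nonincreasing for nonnegative
   times; [v] decays at half the rate of its square. *)
pose k := (2 * C)^-1.
have k0 : 0 < k by rewrite invr_gt0 mulr_gt0.
pose W t := expR (2 * k * t) * V t.
have dV (t : R) : is_derive t 1 V (- dirichlet A p (fun a => v a t / p a)).
  rewrite dirichletE // opprK mulr_sumr.
  rewrite [V](_ : _ = \sum_a (fun s => v a s ^+ 2 / p a)); last first.
    by apply/funext => s; rewrite fct_sumE.
  apply: is_derive_sum => a.
  have e : (fun s => v a s ^+ 2 / p a) = (p a)^-1 \*: (v a ^+ 2).
    by apply/funext => s; rewrite /= mulrC.
  rewrite e; have h := is_deriveX 2 (dv a t).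
  have := is_deriveZ (p a)^-1 h.
  congr (is_derive _ _ _ _).
  by rewrite /GRing.scale /= expr1; ring.
have dW (t : R) : is_derive t 1 W (expR (2 * k * t) *
    (2 * k * V t - dirichlet A p (fun a => v a t / p a))).
  have := is_deriveM (is_derive_expR_scale (2 * k) t) (dV t).
  congr (is_derive _ _ _ _).
  by rewrite /GRing.scale /=; ring.
have W_le t : 0 <= t -> W t <= W 0.
  move=> t0; apply: (@ler0_derive1_nincry _ W 0) => //.
  - move=> x _; rewrite derive1E derive_val pmulr_rle0 ?expR_gt0 // subr_le0.
    rewrite /k invfM mulrA mulfV ?pnatr_eq0 // mul1r mulrC ler_pdivrMr //.
    by rewrite mulrC CP.
  - by apply: continuous_subspaceT; exact: (is_derive_continuous dW).
have V0 t : 0 <= V t.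
  by apply: sumr_ge0 => b _; rewrite divr_ge0 ?sqr_ge0 // ltW.
exists k => //; exists (Num.sqrt (V 0)) => [|a t t0]; first exact: sqrtr_ge0.
(* Since [p a] is at most 1, dividing by it can only increase [v a t ^+ 2], so [V t] bounds each
   squared coordinate. *)
have pa1 : p a <= 1.
  case: statp => _ [p0 <-]; rewrite [leRHS](bigD1 a) //= lerDl.
  by apply: sumr_ge0.
have vV : v a t ^+ 2 <= V t.
  rewrite /V (bigD1 a) //= (le_trans (y := v a t ^+ 2 / p a)) //.
    by rewrite ler_pdivlMr // ler_piMr // sqr_ge0.
  rewrite lerDl; apply: sumr_ge0 => b _.
  by rewrite divr_ge0 ?sqr_ge0 // ltW.
rewrite -(@ler_pXn2r _ 2) ?nnegrE ?mulr_ge0 ?sqrtr_ge0 ?expR_ge0 //.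
rewrite exprMn sqr_sqrtr // real_normK ?num_real // (le_trans vV) //.
have := W_le _ t0; rewrite /W mulr0 expR0 mul1r => h.
rewrite expr2 -expRD -ler_pdivrMr ?expR_gt0 // -expRN mulrC.
by rewrite (_ : - _ = 2 * k * t) //; ring.
Qed.

Definition deviation a b (t : R) : R := expmx (t *: A) a b - p a.

Lemma is_derive_deviation a b (t : R) :
  is_derive t 1 (deviation a b) (\sum_c A a c * deviation c b t).
Proof.
have := is_deriveB (is_derive_expmx A a b t) (is_derive_cst (p a) t 1).
congr (is_derive _ _ _ _); rewrite subr0 mxE.
under [RHS]eq_bigr do rewrite mulrBr.
by case: statp => Ap _; rewrite sumrB Ap subr0.
Qed.

Lemma deviation0 a b : deviation a b 0 = (a == b)%:R - p a.
Proof. by rewrite /deviation expmx0 mxE. Qed.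

(** The sum is constant in time because the columns of [A] sum to zero, and at time 0 it is
    [1 - 1]. *)
Lemma sum_deviation b t : \sum_a deviation a b t = 0.
Proof.
have dS (s : R) : is_derive s 1 (\sum_a deviation a b) 0.
  have := @is_derive_sum _ _ _ _ _ s 1 _ (fun a => is_derive_deviation a b s).
  congr (is_derive _ _ _ _); rewrite exchange_big big1 //= => c _.
  by rewrite -mulr_suml rate_matrix_col_sum // mul0r.
have := is_derive_0_is_cst t 0 dS; rewrite !fct_sumE => ->.
under eq_bigr do rewrite deviation0.
rewrite sumrB (bigD1 b) //= eqxx big1 => [|a /negPf -> //].
by case: statp => _ [_ ->]; rewrite addr0 subrr.
Qed.

Lemma continuous_deviation a b : continuous (deviation a b).
Proof. exact: (is_derive_continuous (is_derive_deviation a b)). Qed.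

Lemma integrable_deviation a b : mu.-integrable halfline (EFin \o deviation a b).
Proof.
have [k k0 [K K0 KP]] :=
  solution_decay (fun a => is_derive_deviation a b) (sum_deviation b).
apply: (integrable_decay K0 k0); first exact: continuous_deviation.
exact: KP.
Qed.

(** Moves coordinate sums and rows of [A] through the integral defining [fundamental]. Integrability
    is carried along because the induction step needs it for additivity. *)
Lemma Rintegral_lincomb (I : Type) (s : seq I) (c : I -> R) (g : I -> R -> R) :
  (forall i, mu.-integrable halfline (EFin \o g i)) ->
  mu.-integrable halfline (EFin \o (fun t => \sum_(i <- s) c i * g i t)) /\
  \int[mu]_(t in halfline) (\sum_(i <- s) c i * g i t) =
  \sum_(i <- s) c i * \int[mu]_(t in halfline) g i t.
Proof.
move=> ig; elim: s => [|i s [IH1 IH2]].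
  rewrite [X in EFin \o X](_ : _ = fun=> 0); last first.
    by apply/funext => t; rewrite big_nil.
  under eq_Rintegral do rewrite big_nil.
  by rewrite big_nil Rintegral_cst // mul0r; split => //; exact: integrable0.
have iZ : mu.-integrable halfline (EFin \o (fun t => c i * g i t)).
  by apply: eq_integrable (integrableZl _ (c i) (ig i)).
have -> : (fun t => \sum_(j <- i :: s) c j * g j t) =
    (fun t => c i * g i t + \sum_(j <- s) c j * g j t).
  by apply/funext => t; rewrite big_cons.
rewrite big_cons RintegralD // IH2 RintegralZl //; split => //.
by apply: eq_integrable (integrableD _ iZ IH1).
Qed.

Lemma sum_fundamental b : \sum_a fundamental A p a b = 0.
Proof.
under eq_bigr do rewrite mxE -[Rintegral _ _ _]mul1r.
rewrite -(Rintegral_lincomb _ (fun=> 1) (fun a => integrable_deviation a b)).2.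
under eq_Rintegral => t _.
  under eq_bigr do rewrite mul1r.
  rewrite sum_deviation; over.
by rewrite Rintegral_cst // mul0r.
Qed.

(** The integrated combination is the derivative of [deviation a b], which tends to 0, so the
    integral is minus its initial value. *)
Lemma mul_fundamental a b :
  \sum_c A a c * fundamental A p c b = p a - (a == b)%:R.
Proof.
under eq_bigr do rewrite mxE.
rewrite -(Rintegral_lincomb _ (A a) (fun c => integrable_deviation c b)).2.
have [k k0 [K K0 KP]] :=
  solution_decay (fun a => is_derive_deviation a b) (sum_deviation b).
rewrite -opprB -deviation0.
(* The integrand is a row of [A] applied to deviations bounded by [K * expR (- k * t)], and
   [mxnorm1 A] bounds the absolute sum of that row. *)
apply: (@Rintegral_FTC2y_decay _ (mxnorm1 A * K) k) => //.
- by rewrite mulr_ge0 // mxnorm1_ge0.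
- apply: (@is_derive_continuous _ _ (fun t => \sum_c A a c *
    \sum_d A c d * deviation d b t)) => t.
  rewrite [X in is_derive _ _ X](_ : _ = \sum_c (A a c \*: deviation c b)).
    by apply: is_derive_sum => c; apply: is_deriveZ; exact: is_derive_deviation.
  by apply/funext => s; rewrite fct_sumE.
- move=> t; exact: is_derive_deviation.
- move=> t t0; rewrite -mulrA (le_trans (ler_norm_sum _ _ _)) //.
  rewrite (le_trans (y := \sum_c `|A a c| * (K * expR (- k * t)))) //.
    by apply: ler_sum => c _; rewrite normrM ler_wpM2l // KP.
  by rewrite -mulr_suml ler_wpM2r ?mxnorm1_row // mulr_ge0 // expR_ge0.
- have cK : (K * expR (- k * t) @[t --> +oo] --> (0 : R))%classic.
    rewrite -[X in (_ --> X)%classic](mulr0 K).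
    by apply: cvgMr; exact: cvg_expRN_scale.
  have cNK : (- (K * expR (- k * t)) @[t --> +oo] --> (0 : R))%classic.
    by rewrite -[X in (_ --> X)%classic]oppr0; exact: cvgN.
  apply: (squeeze_cvgr _ cNK cK).
  near=> t; rewrite -ler_norml; apply: KP; near: t.
  exact: nbhs_pinfty_ge.
Unshelve. all: by end_near.
Qed.

End FundamentalMatrix.

(** * Effect of changing the single rate from [j] to [i] *)

Section RateChange.
Variables (R : realType) (N : nat) (r : 'I_N -> 'I_N -> R) (i j : 'I_N).
Hypothesis ij : i != j.
Hypothesis r0 : forall a b, a != b -> ~~ ((a == i) && (b == j)) -> 0 <= r a b.

Lemma rate_mx_rate_matrix x : 0 < x -> rate_matrix (rate_mx r i j x).
Proof.
move=> x0; split => [a b ab|b].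
  rewrite mxE (negPf ab) /offdiag_rate; case: ifPn => [_|]; first exact: ltW.
  exact: r0.
rewrite mxE eqxx; congr (- _); apply: eq_bigr => a ab.
by rewrite mxE (negPf ab).
Qed.

(** Only column [j] sees the rate: entry [(i, j)] gains [x - y], and the diagonal entry [(j, j)]
    loses as much to keep the column sum zero. *)
Lemma rate_mx_shift x y a b : rate_mx r i j x a b =
  rate_mx r i j y a b + (x - y) * ((a == i)%:R - (a == j)%:R) * (b == j)%:R.
Proof.
rewrite !mxE /offdiag_rate; have [->|bj] := eqVneq b j; last first.
  rewrite mulr0 addr0; case: eqP => // _; rewrite ?andbF //.
  by congr (- _); apply: eq_bigr => c _; rewrite andbF.
rewrite mulr1; have [->|aj] := eqVneq a j.
  rewrite (bigD1 i) //= [in RHS](bigD1 i) //= eqxx /=.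
  rewrite [j == i]eq_sym (negPf ij).
  under eq_bigr => c /andP[_ /negPf ->] do rewrite /=.
  under [in RHS]eq_bigr => c /andP[_ /negPf ->] do rewrite /=.
  by rewrite mulr0n; ring.
by case: eqP => _ /=; rewrite !(mulr0n, mulr1n); ring.
Qed.

(** The factor [k] is common to all [l], so it comes out of [resp] for any coefficients. It exists
    because both differences are zero-sum and the generator at [y] maps them to multiples of the
    same vector. *)
Lemma fundamental_diff_colinear x y (px py : 'I_N -> R) :
  0 < x -> 0 < y ->
  irreducible (rate_mx r i j x) -> irreducible (rate_mx r i j y) ->
  stationary (rate_mx r i j x) px -> stationary (rate_mx r i j y) py ->
  exists k, forall l,
    fundamental (rate_mx r i j x) px l i - fundamental (rate_mx r i j x) px l j
    = k * (fundamental (rate_mx r i j y) py l i -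
           fundamental (rate_mx r i j y) py l j).
Proof.
move=> x0 y0 irrx irry sx sy.
have rx := rate_mx_rate_matrix x0; have ry := rate_mx_rate_matrix y0.
set Zx := fundamental _ px; set Zy := fundamental _ py.
pose w l := Zx l i - Zx l j; pose u l := Zy l i - Zy l j.
have Aw a : \sum_b rate_mx r i j x a b * w b = (a == j)%:R - (a == i)%:R.
  rewrite /w; under eq_bigr do rewrite mulrBr.
  by rewrite sumrB !mul_fundamental //; ring.
have Au a : \sum_b rate_mx r i j y a b * u b = (a == j)%:R - (a == i)%:R.
  rewrite /u; under eq_bigr do rewrite mulrBr.
  by rewrite sumrB !mul_fundamental //; ring.
(* Subtracting the rank-one shift from the equation for [w] shows that the generator at [y] sends
   [w] to [(1 + (x - y) * w j) (e_j - e_i)], which is this factor times the image of [u]. *)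
exists (1 + (x - y) * w j) => l; apply/eqP; rewrite -subr_eq0; apply/eqP.
rewrite -/(w l) -/(u l).
apply: (@kernel_sum0 _ _ _ _ ry irry sy
  (fun l => w l - (1 + (x - y) * w j) * u l)) => [a|].
  have e b : rate_mx r i j y a b * (w b - (1 + (x - y) * w j) * u b) =
     rate_mx r i j x a b * w b
     - (x - y) * ((a == i)%:R - (a == j)%:R) * ((b == j)%:R * w b)
     - (1 + (x - y) * w j) * (rate_mx r i j y a b * u b).
    by rewrite (rate_mx_shift x y); ring.
  under eq_bigr do rewrite e.
  rewrite !sumrB -!mulr_sumr Aw Au (bigD1 j) //= eqxx big1 => [|b /negPf ->].
    by rewrite mulr1n; ring.
  by rewrite mul0r.
rewrite sumrB -mulr_sumr /w /u !sumrB !sum_fundamental //.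
by rewrite !subr0 mulr0 subr0.
Qed.

End RateChange.

(** * Local constancy of the response ratio *)

Theorem theorem2 (R : realType) (N : nat) (r : 'I_N -> 'I_N -> R) (i j : 'I_N)
  (pi : R -> 'I_N -> R)
  (a1 a2 : 'I_N -> R) (b1 b2 : 'I_N -> 'I_N -> R) :
  i != j ->
  (forall a b, a != b -> ~~ ((a == i) && (b == j)) -> 0 <= r a b) ->
  (forall x, 0 < x -> irreducible (rate_mx r i j x)) ->
  (forall x, 0 < x -> stationary (rate_mx r i j x) (pi x)) ->
  let chi := fun x : R =>
    resp (fundamental (rate_mx r i j x) (pi x)) (coef_c r i j a1 b1) i j /
    resp (fundamental (rate_mx r i j x) (pi x)) (coef_c r i j a2 b2) i j in
  forall x : R, 0 < x ->
    resp (fundamental (rate_mx r i j x) (pi x)) (coef_c r i j a2 b2) i j != 0 ->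
    is_derive x 1 chi 0.
Proof.
move=> ij r0 irr stat chi x x0 den0.
apply: (near_eq_is_derive _ (is_derive_cst (chi x) x 1)).
near=> y; have y0 : 0 < y by near: y; exact: lt_nbhsr.
have [k kP] := fundamental_diff_colinear ij r0 x0 y0
  (irr _ x0) (irr _ y0) (stat _ x0) (stat _ y0).
have respE c : resp (fundamental (rate_mx r i j x) (pi x)) c i j =
    k * resp (fundamental (rate_mx r i j y) (pi y)) c i j.
  by rewrite /resp mulr_sumr; apply: eq_bigr => l _; rewrite kP mulrCA.
(* Expressing the responses at [x] through those at [y] lets the nonzero denominator at [x] alone
   give [k != 0], after which [k] cancels. *)
have k0 : k != 0 by apply: contraNneq den0 => k0; rewrite respE k0 mul0r.
by rewrite /chi /= !respE invfM mulrACA mulfV // mul1r.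
Unshelve. all: by end_near.
Qed.
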